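(* Let $\mathcal{H}$ be a real Hilbert space, let $m$ be a positive integer, let $T:\mathcal{H}\to\mathcal{H}$ be a continuous linear self-adjoint operator, let $T_1,\dots,T_m:\mathcal{H}\to\mathcal{H}$ be positive semidefinite continuous linear self-adjoint operators, and let $c,c_1,\dots,c_m\in\mathcal{H}$, $\alpha_1,\dots,\alpha_m\in\mathbb{R}$. Put $f(x)=\frac12\langle x,Tx\rangle+\langle c,x\rangle$, $g_i(x)=\frac12\langle x,T_ix\rangle+\langle c_i,x\rangle+\alpha_i$ and $F=\{x\in\mathcal{H}\mid g_i(x)\leqslant 0,\ i=1,\dots,m\}$. Suppose that $\langle x,Tx\rangle$ is a Legendre form, that $F$ is nonempty and $f$ is bounded from below over $F$, and that condition (A) holds: for every $v\in 0^+F$ with $\langle v,Tv\rangle=0$ one has $\langle c_i,v\rangle=0$ for all $i\in I_1$, where $I_1=\{i\in\{1,\dots,m\}\mid T_i\neq 0\}$ (the condition being vacuously satisfied if $I_1=\emptyset$). Then the problem of minimizing $f(x)$ subject to $x\in F$ has a solution, i.e. there is $\bar x\in F$ with $f(\bar x)\leqslant f(x)$ for all $x\in F$.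
   Context: A continuous linear self-adjoint operator $S$ on $\mathcal{H}$ is positive semidefinite if $\langle x,Sx\rangle\geqslant 0$ for all $x\in\mathcal{H}$. A continuous quadratic form $Q(x)=\langle x,Tx\rangle$ on $\mathcal{H}$ is a Legendre form if (a) $Q$ is weakly lower semicontinuous, and (b) $x_k\to x_0$ strongly whenever $x_k\rightharpoonup x_0$ (weak convergence) and $Q(x_k)\to Q(x_0)$. The recession cone of a nonempty closed convex set $X\subset\mathcal{H}$ is $0^+X=\{v\in\mathcal{H}\mid x+tv\in X\ \ \forall x\in X,\ \forall t\geqslant 0\}$. *)

(* Defs.v *)
From HB Require Import structures.
From mathcomp Require Import all_boot all_order all_algebra.
From mathcomp Require Import sesquilinear.
From mathcomp Require Import all_classical all_reals all_analysis.

Set Implicit Arguments.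
Unset Strict Implicit.
Unset Printing Implicit Defensive.

Import Order.TTheory GRing.Theory Num.Theory.
Import numFieldNormedType.Exports.

Local Open Scope classical_set_scope.
Local Open Scope ring_scope.

Section WeakTopology.
Context {R : realType} (V : normedModType R).

Definition continuous_functional : Type :=
  {phi : {linear V -> R^o} | continuous phi}.

(* The weak topology of V: the coarsest one making all continuous linear
   functionals continuous. [weak] is convertible to V; the type annotation
   [x : weak V] selects the topology used by nbhs, --> and
   lower_semicontinuous. *)
Definition weak : Type :=
  sup_topology (fun phi : continuous_functional =>
    Topological.on (initial_topology (sval phi : V -> R^o))).

HB.instance Definition _ := Topological.on weak.

Definition weakly_lsc (Q : V -> R) : Prop :=
  lower_semicontinuous (fun x : weak => (Q x)%:E).

Definition weakly_cvg (x_ : nat -> V) (x0 : V) : Prop :=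
  (x_ : nat -> weak) @ \oo --> (x0 : weak).

Lemma weakly_cvgP (x_ : nat -> V) (x0 : V) :
  weakly_cvg x_ x0 <->
  forall phi : {linear V -> R^o}, continuous phi ->
    phi (x_ k) @[k --> \oo] --> phi x0.
Proof.
rewrite /weakly_cvg; split.
  move=> /cvg_sup h phi cphi.
  have {}h := h (exist _ phi cphi).
  apply: (@cvg_comp _ _ _ x_ phi _ _ _ h).
  exact: (@initial_continuous V R^o phi x0).
move=> h; apply/cvg_sup => -[phi cphi] A [_ [[B oB <-] /= Bx0] BA].
apply: (filterS BA); apply: (h phi cphi B).
exact: open_nbhs_nbhs.
Qed.

(* Continuity of the quadratic form Q is assumed separately. *)
Definition legendre_form (Q : V -> R) : Prop :=
  weakly_lsc Q /\
  forall (x_ : nat -> V) (x0 : V),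
    weakly_cvg x_ x0 -> Q (x_ k) @[k --> \oo] --> Q x0 ->
    x_ k @[k --> \oo] --> x0.

Definition recession_cone (X : set V) : set V :=
  [set v | forall x, X x -> forall t : R, 0 <= t -> X (x + t *: v)].

End WeakTopology.

Section Operators.
Context {R : realType} {H : normedModType R} (dot : {dot H for @idfun R}).

Definition continuous_self_adjoint (S : {linear H -> H}) : Prop :=
  continuous S /\ forall x y, dot (S x) y = dot x (S y).

Definition positive_semidefinite (S : {linear H -> H}) : Prop :=
  continuous_self_adjoint S /\ forall x, 0 <= dot x (S x).

End Operators.

(* Main.v *)
Require Import Defs.
From mathcomp Require Import all_boot all_order all_algebra.
From mathcomp Require Import sesquilinear.
From mathcomp Require Import all_classical all_reals all_analysis.
From mathcomp Require Import ring lra.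

(** Frank-Wolfe type existence theorem, by the method of points of minimal norm.

    Let fs be the infimum of f over F, and let x_ n have minimal norm among the
    points of F where f is at most fs + 1 / (n + 1); it exists because these sets
    are closed under bounded weak limits ([exists_min_norm]). Fix an ultrafilter U
    above the filter of cofinite sets. If the norms of the x_ n are bounded along
    U, the points converge weakly along U ([ultra_bounded_weakly_to]), and
    the limit is a minimizer, since f and the constraints are weakly lower
    semicontinuous.

    Otherwise the norms tend to infinity along U. Let v be the weak limit of the
    normalized points. Dividing the constraints by the norm and by its square
    shows that the T_i vanish at v and that dot c_i v <= 0, so v is a recession
    direction of F. Likewise dot v (T v) <= 0, and as f is bounded below on the
    half-lines of direction v, dot v (T v) = 0 and f is nondecreasing along v from
    every feasible point. The Legendre property excludes v = 0
    ([legendre_cvg]). Now move from x_ n to x_ n - t v with a small t > 0. The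
    objective does not increase. By condition (A), a constraint with T_i != 0 does
    not change; an affine constraint either has slope 0 along v, or has negative
    slope and is then slack at x_ n for U-many n. So the point stays in its level
    set, and its norm decreases since dot (x_ n) v > 0 for U-many n. This
    contradicts the minimality of the norm of x_ n.

    Ultrafilters give weak limits at once, with no separability assumption. Only
    the Legendre property refers to genuine sequences; it is carried over to filters
    by extracting an asymptotically orthogonal sequence
    ([extract_asymptotically_orthogonal]), which is automatically weakly null
    ([asymptotically_orthogonal_weakly_to0]). *)

Set Implicit Arguments.
Unset Strict Implicit.

Import Order.TTheory GRing.Theory Num.Theory.
Import numFieldNormedType.Exports.

Local Open Scope classical_set_scope.
Local Open Scope ring_scope.

(** * Real polynomials of degree at most two *)

(** First-order optimality: a real function with value and minimum 0 at
    t = 0 has derivative 0 there. *)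
Lemma quadratic_ge0_linear_eq0 (R : realFieldType) (a b : R) :
  (forall t, 0 <= 2 * t * b + t ^+ 2 * a) -> b = 0.
Proof.
move=> h; have A0 : 0 < `|a| + 1 by rewrite ltr_wpDl.
(* This t nearly minimizes the quadratic, which is then at most
   - b ^+ 2 / (`|a| + 1); the absolute value covers a <= 0. *)
have := h (- b / (`|a| + 1)).
have -> : 2 * (- b / (`|a| + 1)) * b + (- b / (`|a| + 1)) ^+ 2 * a =
    (b ^+ 2 * (a - 2 * (`|a| + 1))) / (`|a| + 1) ^+ 2.
  by field; rewrite gt_eqF.
rewrite pmulr_lge0 ?invr_gt0 ?exprn_gt0//.
rewrite nmulr_lge0; last by have := ler_norm a; lra.
move=> b2; apply/eqP; rewrite -sqrf_eq0; apply/eqP.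
by apply/le_anti; rewrite b2 sqr_ge0.
Qed.

(** This is how boundedness from below along a half-line is used: the curvature
    of the restriction cannot be negative, and once it vanishes the slope cannot
    be negative either. *)
Lemma parabola_lbound (R : realFieldType) (m a b q : R) :
  (forall t, 0 <= t -> m <= a + t * b + t ^+ 2 * q) ->
  q <= 0 -> q = 0 /\ 0 <= b.
Proof.
move=> h q0.
have bq t : 0 <= t -> m - a <= t * b + t ^+ 2 * q.
  by move=> /h; lra.
have tb t : 0 <= t -> m - a <= t * b.
  by move=> t0; have := bq t t0; have := sqr_ge0 t; nra.
have b0 : 0 <= b.
  rewrite leNgt; apply/negP => b0.
  have u0 : 0 <= (`|m - a| + 1) / - b by rewrite divr_ge0 ?addr_ge0// oppr_ge0 ltW.
  have := tb _ u0.
  have -> : (`|m - a| + 1) / - b * b = - (`|m - a| + 1).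
    by field; rewrite lt_eqF.
  by have := ler_norm (- (m - a)); rewrite normrN; lra.
split => //; apply/le_anti; rewrite q0/= leNgt; apply/negP => {}q0.
(* At t = s / - q + 1 the quadratic term beats both b and the bound m - a. *)
pose s := `|m - a| + b + 1.
have s1 : 1 <= s by rewrite /s; have := normr_ge0 (m - a); lra.
have := bq (s / - q + 1).
have u0 : 0 < s / - q by rewrite divr_gt0 ?oppr_gt0//; lra.
have uq : s / - q * q = - s by field; rewrite lt_eqF.
move=> /(_ ltac:(lra)).
set u := s / - q in u0 uq *.
have -> : (u + 1) * b + (u + 1) ^+ 2 * q =
  (u + 1) * (b - s) + (u + 1) * q by rewrite -uq; ring.
have := ler_norm (- (m - a)); rewrite normrN /s.
have := normr_ge0 (m - a); set n := `|m - a|.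
by nra.
Qed.

Lemma near_right0_affine_lt0 (R : realType) (a b : R) : a < 0 ->
  \forall t \near 0^'+, a + t * b < 0.
Proof.
move=> a0; have c0 : 0 < - a / (`|b| + 1) by rewrite divr_gt0 ?oppr_gt0// ltr_wpDl.
near=> t; have t0 : 0 < t by near: t; exact: nbhs_right_gt.
have : t < - a / (`|b| + 1) by near: t; exact: nbhs_right_lt.
by rewrite ltr_pdivlMr ?ltr_wpDl//; have := ler_norm b; nra.
Unshelve. all: by end_near. Qed.

(** * Ultrafilters *)

(** If the preimage of a neighbourhood of l were not in F, its complement could
    be adjoined to F, and an ultrafilter above the result would contain both
    the preimage and its complement. *)
Lemma cvg_ultra (T : Type) (X : topologicalType) (F : set_system T)
    (f : T -> X) (l : X) : Filter F ->
  (forall U, UltraFilter U -> F `<=` U -> f @ U --> l) -> f @ F --> l.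
Proof.
move=> FF h B lB; apply: contrapT => nFB.
have PF : ProperFilter (within (~` (f @^-1` B)) F).
  apply: Build_ProperFilter_ex => A FA.
  apply: contrapT => nA; apply: nFB; rewrite /within /= in FA.
  change (F (f @^-1` B)); apply: filterS FA => x Ax; apply: contrapT => nBx.
  by apply: nA; exists x; exact: Ax.
have [U [UU FU]] := ultraFilterLemma PF.
have UB : U (f @^-1` B).
  by apply: (h U UU _ B lB) => A FA; apply: FU; rewrite /within /=; apply: filterS FA.
have UnB : U (~` (f @^-1` B)) by apply: FU; exact: withinT.
by have /filter_ex [x []] : U (f @^-1` B `&` ~` (f @^-1` B)) by exact: filterI.
Qed.

Lemma ultra_bounded_cvg (R : realType) (I : Type) (U : set_system I)
    (u : I -> R) (M : R) : UltraFilter U ->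
  (\forall i \near U, `|u i| <= M) -> cvg (u i @[i --> U]).
Proof.
move=> UU uM.
have [|l [_ lu]] := @segment_compact R (- M) M (u @ U) _.
  by apply: filterS uM => i; rewrite /= in_itv/= ler_norml.
apply/cvg_ex; exists l => B lB.
have [//|nB] := in_ultra_setVsetC (u @^-1` B) UU.
by have [x []] := lu (~` B) B nB lB.
Qed.

(** * Real inner products *)

Section InnerProduct.
Context {R : realType} {H : normedModType R} (dot : {dot H for @idfun R}).
Implicit Types x y z : H.

Lemma dotC x y : dot x y = dot y x.
Proof. by rewrite (@hermitian_subproof _ _ _ _ dot) expr0 mul1r. Qed.

Lemma dotZl a x y : dot (a *: x) y = a * dot x y.
Proof. exact: linearZl_LR. Qed.

Lemma dotZr a x y : dot x (a *: y) = a * dot x y.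
Proof. by rewrite dotC dotZl dotC. Qed.

Lemma dotDl x y z : dot (x + y) z = dot x z + dot y z.
Proof. exact: linearDl. Qed.

Lemma dotDr x y z : dot x (y + z) = dot x y + dot x z.
Proof. exact: linearDr. Qed.

Lemma dotNl x y : dot (- x) y = - dot x y.
Proof. exact: linearNl. Qed.

Lemma dotNr x y : dot x (- y) = - dot x y.
Proof. exact: linearNr. Qed.

Lemma dot0l x : dot 0 x = 0.
Proof. exact: linear0l. Qed.

Lemma dot0r x : dot x 0 = 0.
Proof. exact: linear0r. Qed.

Definition dotE := (dotDl, dotDr, dotNl, dotNr, dotZl, dotZr, dot0l, dot0r).

Lemma dot_ge0 x : 0 <= dot x x.
Proof.
have [->|/(@neq0_dnorm_gt0 _ _ _ dot)/ltW//] := eqVneq x 0.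
by rewrite dotE.
Qed.

Lemma dot_eq0 x : dot x x = 0 -> x = 0.
Proof.
have [//|/(@neq0_dnorm_gt0 _ _ _ dot) + e] := eqVneq x 0.
by rewrite e ltxx.
Qed.

Context (norm_dot : forall x, `|x| = Num.sqrt (dot x x)).

Lemma dotxx x : dot x x = `|x| ^+ 2.
Proof. by rewrite norm_dot sqr_sqrtr// dot_ge0. Qed.

Lemma cauchy_schwarz x y : `|dot x y| <= `|x| * `|y|.
Proof.
have [->|y0] := eqVneq y 0; first by rewrite dotE normr0 mulr_ge0.
have yy0 := @neq0_dnorm_gt0 _ _ _ dot _ y0.
rewrite -(ler_pXn2r (_ : 0 < 2)%N) ?nnegrE ?mulr_ge0//.
rewrite exprMn -!dotxx -normrX ger0_norm ?sqr_ge0//.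
rewrite -subr_ge0 -(pmulr_rge0 _ yy0).
(* This vector is dot y y times the component of x orthogonal to y. *)
have := dot_ge0 (dot y y *: x - dot x y *: y).
rewrite !dotE. rewrite (dotC y x).
by congr (_ <= _); ring.
Qed.

Lemma dot_cvg (I : Type) (F : set_system I) (x_ : I -> H) x y : Filter F ->
  x_ i @[i --> F] --> x -> dot (x_ i) y @[i --> F] --> dot x y.
Proof.
move=> FF xx; apply/cvgrPdist_lt => e e0.
have d0 : 0 < e / (`|y| + 1) by rewrite divr_gt0// ltr_wpDl.
move/cvgrPdist_lt: xx => /(_ _ d0); apply: filterS => i.
rewrite ltr_pdivlMr ?ltr_wpDl// => /(le_lt_trans _); apply.
rewrite -dotNl -dotDl; apply: (le_trans (cauchy_schwarz _ _)).
by rewrite ler_wpM2l// lerDl.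
Qed.

End InnerProduct.

(** * Riesz representation and weak compactness *)

Section WeakConvergence.
Context {R : realType} {H : completeNormedModType R}.
Context (dot : {dot H for @idfun R}).
Context (norm_dot : forall x : H, `|x| = Num.sqrt (dot x x)).
Implicit Types x y z : H.

(** Weak convergence tested on inner products only; this covers all continuous
    linear functionals by the Riesz representation, see [weak_topology_cvg]. *)
Definition weakly_to {I : Type} (F : set_system I) (x_ : I -> H) (x : H) :=
  forall y, dot (x_ i) y @[i --> F] --> dot x y.

(** The representing vector is the minimizer of the strictly convex functional
    J x = dot x x - 2 * phi x. A minimizing sequence is Cauchy by the
    parallelogram identity, and the first-order condition at its limit z is
    dot z y = phi y. Linearity and boundedness are plain hypotheses on phi so
    that pointwise limits of functionals can be represented without building a
    bundled linear map. *)
Lemma riesz_representation (phi : H -> R) (M : R) :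
  (forall a x y, phi (a *: x + y) = a * phi x + phi y) ->
  (forall x, `|phi x| <= M * `|x|) ->
  exists z, forall y, phi y = dot z y.
Proof.
move=> phiP phiM.
pose J x := dot x x - 2 * phi x.
have JM x : - M ^+ 2 <= J x.
  rewrite /J (dotxx norm_dot).
  have := phiM x; have := ler_norm (phi x); have := sqr_ge0 (`|x| - M).
  by lra.
have hJ : has_inf (range J).
  split; first by exists (J 0), 0.
  by exists (- M ^+ 2) => _ [x _ <-].
pose r := inf (range J).
have rJ x : r <= J x by apply: ge_inf; [exact: hJ.2 | exists x].
have /choice[u uP] n : exists x, J x < r + harmonic n.
  have n0 : 0 < harmonic n :> R by rewrite harmonic_gt0.
  by have [_ [x _ <-] xr] := inf_adherent n0 hJ; exists x.
have JD x y t : J (x + t *: y) =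
    J x + 2 * t * (dot x y - phi y) + t ^+ 2 * dot y y.
  by rewrite /J [X in phi X]addrC phiP !(dotE dot) (dotC dot y x); ring.
have par m n : `|u m - u n| ^+ 2 <= 2 * (harmonic m + harmonic n).
  rewrite distrC -(dotxx norm_dot); set d := u n - u m.
  have Jn : J (u n) = J (u m) + 2 * (dot (u m) d - phi d) + dot d d.
    have := JD (u m) d 1; rewrite scale1r mulr1 expr1n mul1r => <-.
    by rewrite /d addrC subrK.
  have := rJ (u m + 2^-1 *: d); rewrite JD divff// mul1r.
  have -> : 2^-1 ^+ 2 = 4^-1 :> R by field.
  by have := uP m; have := uP n; rewrite Jn; lra.
have cu : cvg (u @ \oo).
  apply/cauchy_cvgP/cauchy_ballP => e e0.
  have e1 : 0 < e ^+ 2 / 4 by rewrite divr_gt0// exprn_gt0.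
  have Ne := near_infty_natSinv_lt (PosNum e1).
  pose N := [set n | harmonic n < e ^+ 2 / 4 :> R].
  have uN : (u @ \oo) (u @` N) by apply: filterS Ne => n Nn; exists n.
  exists (u @` N, u @` N) => // -[_ _] [[m mlt <-] [n nlt <-]].
  rewrite -ball_normE.
  change (`|u m - u n| < e); rewrite -(ltr_pXn2r (_ : 0 < 2)%N) ?nnegrE ?(ltW e0)//.
  apply: (le_lt_trans (par m n)); rewrite /N /mkset in mlt nlt; lra.
exists (lim (u @ \oo)) => y; set z := lim _.
apply/esym/eqP; rewrite -subr_eq0; apply/eqP.
(* The first-order condition at z is the limit of inequalities that express the
   near-optimality of u n. *)
apply: (@quadratic_ge0_linear_eq0 _ (dot y y)) => t.
have cd : 2 * t * (dot (u n) y - phi y) + t ^+ 2 * dot y y + harmonic n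
    @[n --> \oo] --> 2 * t * (dot z y - phi y) + t ^+ 2 * dot y y + 0.
  apply: cvgD; last exact: cvg_harmonic.
  apply: cvgD; last exact: cvg_cst.
  apply: cvgMr; apply: cvgB; last exact: cvg_cst.
  exact: (dot_cvg norm_dot).
rewrite addr0 in cd; apply: (cvgr_to_ge cd).
apply: nearW => n; have := rJ (u n + t *: y); have := uP n.
by rewrite JD; lra.
Qed.

Lemma weak_topology_cvg (I : Type) (F : set_system I) (x_ : I -> H) x
    {FF : Filter F} : weakly_to F x_ x -> (x_ : I -> weak H) @ F --> (x : weak H).
Proof.
move=> wx; apply/cvg_sup => -[phi cphi] A [_ [[B oB <-] /= Bx] BA].
apply: (filterS BA).
have /linear_boundedP/pinfty_ex_gt0[M _ phiM] :=
  continuous_linear_bounded 0 (cphi 0).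
have [|z phiz] := @riesz_representation phi M _ phiM.
  by move=> a y1 y2; rewrite linearP.
have wz : phi (x_ i) @[i --> F] --> (phi x : R).
  rewrite phiz dotC (_ : (fun i => _) = (fun i => dot (x_ i) z)); first exact: wx.
  by apply/funext => i; rewrite phiz dotC.
by apply: (wz B); exact: open_nbhs_nbhs.
Qed.

(** Weak compactness of balls, without separability or a diagonal argument: along
    an ultrafilter every inner product converges, and the limits form a bounded
    linear functional. *)
Lemma ultra_bounded_weakly_to (I : Type) (U : set_system I) (x_ : I -> H)
    (M : R) : UltraFilter U ->
  (\forall i \near U, `|x_ i| <= M) -> exists x, weakly_to U x_ x.
Proof.
move=> UU xM.
have bnd y : \forall i \near U, `|dot (x_ i) y| <= M * `|y|.
  apply: filterS xM => i xM; apply: (le_trans (cauchy_schwarz norm_dot _ _)).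
  by rewrite ler_wpM2r.
have cv y := ultra_bounded_cvg UU (bnd y).
have [||z zP] := @riesz_representation (fun y => lim (dot (x_ i) y @[i --> U])) M.
- move=> a y z; apply: cvg_lim => //.
  rewrite (_ : (fun i => _) = (fun i => a * dot (x_ i) y + dot (x_ i) z)).
    by apply: cvgD; [apply: cvgMr; exact: cv|exact: cv].
  by apply/funext => i; rewrite dotDr dotZr.
- by move=> y; apply: (cvgr_to_le (cvg_norm (cv y))); exact: bnd.
by exists z => y; rewrite -zP; exact: cv.
Qed.

End WeakConvergence.

(** * Weak lower semicontinuity *)

Section WeakLowerSemicontinuity.
Context {R : realType} {H : completeNormedModType R}.
Context (dot : {dot H for @idfun R}).
Context (norm_dot : forall x : H, `|x| = Num.sqrt (dot x x)).
Implicit Types x y z : H.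

(** The variable upper bound [b_] lets the value of Q be compared with the
    remaining, weakly continuous, terms of a quadratic function. *)
Definition lsc_along_weak (Q : H -> R) := forall (I : Type) (F : set_system I)
    (x_ : I -> H) (x : H) (b_ : I -> R) (b : R), ProperFilter F ->
  weakly_to dot F x_ x -> (\forall i \near F, Q (x_ i) <= b_ i) ->
  b_ i @[i --> F] --> b -> Q x <= b.

Lemma weakly_lsc_lsc_along_weak (Q : H -> R) : weakly_lsc Q -> lsc_along_weak Q.
Proof.
move=> lscQ I F x_ x b_ b FF wx Qb bb; rewrite leNgt; apply/negP => bQ.
pose a := (b + Q x) / 2.
have [|V Vx VQ] := lscQ x a; first by rewrite lte_fin /a; lra.
have FV : F (x_ @^-1` V) by exact: (weak_topology_cvg norm_dot wx Vx).
have ba : b < a by rewrite /a; lra.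
have Fb : \forall i \near F, b_ i < a by by move/cvgr_lt: bb; exact.
near F => i.
have xV : V (x_ i) by near: i.
have bi : b_ i < a by near: i.
have Qi : Q (x_ i) <= b_ i by near: i.
by have := VQ _ xV; rewrite lte_fin ltNge (le_trans Qi (ltW bi)).
Unshelve. all: by end_near. Qed.

(** A positive semidefinite form is convex, hence minorized by its tangent at
    x, and this tangent is weakly continuous. *)
Lemma psd_lsc_along_weak (S : {linear H -> H}) :
  positive_semidefinite dot S -> lsc_along_weak (fun x => dot x (S x)).
Proof.
move=> [[_ symS] posS] I F x_ x b_ b FF wx Qb bb.
have tangent y : 2 * dot y (S x) - dot x (S x) <= dot y (S y).
  have := posS (y - x); rewrite linearB !(dotE dot).
  by rewrite -(symS x y) (dotC dot (S x)); lra.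
have cx : 2 * dot (x_ i) (S x) - dot x (S x) @[i --> F] -->
    2 * dot x (S x) - dot x (S x).
  by apply: cvgB; [apply: cvgMr; exact: wx|exact: cvg_cst].
have : 2 * dot x (S x) - dot x (S x) <= b.
  rewrite -subr_ge0; apply: (cvgr_to_ge (cvgB bb cx)).
  apply: filterS Qb => i Qb; rewrite subr_ge0.
  exact: le_trans (tangent _) Qb.
by rewrite mulr_natl mulr2n addrK.
Qed.

Lemma norm_lsc_along_weak : lsc_along_weak (fun x => `|x| ^+ 2).
Proof.
have psd1 : positive_semidefinite dot (idfun : {linear H -> H}).
  split=> [|x]; last exact: dot_ge0.
  by split=> // x; exact: cvg_id.
move=> I F x_ x b_ b FF wx Qb; rewrite -(dotxx norm_dot).
apply: (psd_lsc_along_weak psd1 FF wx).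
by apply: filterS Qb => i; rewrite -(dotxx norm_dot).
Qed.

(** Such a v minimizes the form, so that the derivative 2 * S v vanishes. *)
Lemma psd_ker (S : {linear H -> H}) v :
  positive_semidefinite dot S -> dot v (S v) <= 0 -> S v = 0.
Proof.
move=> [[_ symS] posS] v0; have {}v0 : dot v (S v) = 0.
  by apply/le_anti; rewrite v0 posS.
apply: (dot_eq0 (dot := dot)).
apply: (@quadratic_ge0_linear_eq0 _ (dot (S v) (S (S v)))) => t.
have := posS (v + t *: S v); rewrite linearD linearZ /= !(dotE dot) v0.
by rewrite -(symS v (S v)); congr (_ <= _); ring.
Qed.

(** A weak limit of a norm-minimizing sequence in A lies in A and attains the
    infimum, as the norm is weakly lower semicontinuous. *)
Lemma exists_min_norm (A : set H) : A !=set0 ->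
  (forall (U : set_system nat) (x_ : nat -> H) x, UltraFilter U ->
     (forall n, A (x_ n)) -> weakly_to dot U x_ x -> A x) ->
  exists2 a, A a & forall b, A b -> `|a| <= `|b|.
Proof.
move=> A0 Acl; pose N := [set `|a| | a in A].
have infN : has_inf N.
  split; first by case: A0 => a Aa; exists `|a|, a.
  by exists 0 => _ [a _ <-].
have /choice[u uP] n : exists a, A a /\ `|a| < inf N + harmonic n.
  have [_ [a Aa <-] an] := inf_adherent (harmonic_gt0 n) infN.
  by exists a.
have [U [UU FU]] := @ultraFilterLemma _ \oo _.
have hU : harmonic n @[n --> U] --> (0 : R).
  by move=> B /(@cvg_harmonic R) /FU.
have uM : \forall n \near U, `|u n| <= inf N + 1.
  apply: nearW => n; apply: (le_trans (ltW (uP n).2)).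
  by rewrite lerD2l /= invf_le1// ler1n.
have [a wa] := ultra_bounded_weakly_to norm_dot UU uM.
exists a; first by apply: (Acl U u a UU) => // n; exact: (uP n).1.
move=> b Ab; apply: (@le_trans _ _ (inf N)); last first.
  by apply: ge_inf; [exact: infN.2|exists b].
have N0 : 0 <= inf N by apply: lb_le_inf; [exact: infN.1|move=> _ [c _ <-]].
rewrite -(ler_pXn2r (_ : 0 < 2)%N) ?nnegrE//.
have cb : (inf N + harmonic n) ^+ 2 @[n --> U] --> inf N ^+ 2.
  have cN : inf N + harmonic n @[n --> U] --> inf N.
    by rewrite -[X in _ --> X]addr0; apply: cvgD => //; exact: cvg_cst.
  by under eq_fun do rewrite expr2; rewrite expr2; exact: cvgM.
apply: (norm_lsc_along_weak _ wa _ cb); apply: nearW => n.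
rewrite ler_pXn2r ?nnegrE ?addr_ge0 ?harmonic_ge0//.
exact: ltW (uP n).2.
Qed.

End WeakLowerSemicontinuity.

(** * Legendre forms along filters *)

Section LegendreForms.
Context {R : realType} {H : completeNormedModType R}.
Context (dot : {dot H for @idfun R}).
Context (norm_dot : forall x : H, `|x| = Num.sqrt (dot x x)).
Implicit Types x y z : H.

(** Let z be the weak limit of w along an ultrafilter. Passing to the limit in
    dot (w n) (w j), first in n and then in j, gives dot z (w j) = 0 and
    dot z z = 0. So every ultrafilter gives the weak limit 0. *)
Lemma asymptotically_orthogonal_weakly_to0 (w : nat -> H) (M : R) :
  (forall n, `|w n| <= M) ->
  (forall j, dot (w n) (w j) @[n --> \oo] --> 0) ->
  weakly_to dot \oo w 0.
Proof.
move=> wM w0 y; apply: cvg_ultra => U UU FU.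
have [|z wz] := @ultra_bounded_weakly_to _ _ _ norm_dot _ U w M UU.
  by apply: nearW.
have zw j : dot z (w j) = 0.
  by apply: (cvg_unique _ (wz (w j))) => // B B0; exact: (FU _ (w0 j B B0)).
have : dot z z = 0.
  have cz0 : dot (w n) z @[n --> U] --> (0 : R).
    by under eq_fun do rewrite dotC zw; exact: cvg_cst.
  exact: (cvg_unique _ (wz z) cz0).
by move/dot_eq0 => z0; rewrite -z0; exact: wz.
Qed.

(** A filter need not have a countable base, so a weakly convergent family has
    in general no obvious weakly convergent sequence in it. Choosing each term
    almost orthogonal to the finitely many previous ones produces one. *)
Lemma extract_asymptotically_orthogonal (I : Type) (F : set_system I)
    (z_ : I -> H) (P : nat -> set I) :
  Filter F -> weakly_to dot F z_ 0 ->
  (forall n A, F A -> P n `&` A !=set0) ->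
  exists k : nat -> I, (forall n, P n (k n)) /\
    (forall j, dot (z_ (k n)) (z_ (k j)) @[n --> \oo] --> 0).
Proof.
move=> FF wz PF.
pose p s i := all (fun j => `|dot (z_ i) (z_ j)| < harmonic (size s)) s.
have /choice[h hP] (s : seq I) : exists i, P (size s) i /\ p s i.
  have [|i [Pi pi]] := PF (size s) [set i | p s i]; last by exists i.
  rewrite /p; have := harmonic_gt0 (R := R) (size s); move: (harmonic _) => e e0.
  elim: s => [|j s IHs]; first by apply: filterS filterT => i.
  move/cvgrPdist_lt: (wz (z_ j)) => /(_ e e0) Fj.
  apply: filterS (filterI Fj IHs) => i [].
  by rewrite dot0l sub0r normrN /= => -> ->.
(* [s_ n] lists the n indices chosen so far, the latest one first. *)
pose s_ n := iter n (fun s => h s :: s) [::].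
have size_s n : size (s_ n) = n by elim: n => //= n ->.
exists (h \o s_); split=> [n /=|j].
  by have := (hP (s_ n)).1; rewrite size_s.
have in_s q n : (j < n)%N -> all q (s_ n) -> q (h (s_ j)).
  elim: n => // n IHn; rewrite ltnS leq_eqVlt => /orP[/eqP->|jn] /=.
    by case/andP.
  by case/andP => _; exact: IHn.
apply/cvgrPdist_lt => e e0.
have := near_infty_natSinv_lt (PosNum e0); apply: filterS2 (nbhs_infty_gt j).
move=> n jn ne; rewrite sub0r normrN; apply: lt_trans ne.
have := in_s _ _ jn (hP (s_ n)).2.
by rewrite size_s.
Qed.

(** The definition of a Legendre form speaks of sequences; this is the same
    property for filters. If strong convergence fails, the failing indices meet
    every set of F, and from them one can extract a sequence that converges
    weakly to x and along which Q tends to Q x, but which stays away from x. *)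
Lemma legendre_cvg (Q : H -> R) (I : Type) (F : set_system I) (x_ : I -> H)
    (x : H) (M : R) : ProperFilter F -> legendre_form Q ->
  (\forall i \near F, `|x_ i| <= M) -> weakly_to dot F x_ x ->
  Q (x_ i) @[i --> F] --> Q x -> x_ i @[i --> F] --> x.
Proof.
move=> FF [_ legQ] xM wx Qx; apply/cvgrPdist_lt => e e0.
apply: contrapT => nFe.
have wz : weakly_to dot F (fun i => x_ i - x) 0.
  move=> y; rewrite dot0l -(subrr (dot x y)).
  under eq_fun do rewrite dotDl dotNl.
  by apply: cvgB; [exact: wx|exact: cvg_cst].
pose P n := [set i | [/\ e <= `|x - x_ i|, `|x_ i| <= M &
  `|Q x - Q (x_ i)| < harmonic n]].
have PF n A : F A -> P n `&` A !=set0.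
  move=> FA; apply: contrapT => nPA; apply: nFe.
  move/cvgrPdist_lt: (Qx) => /(_ _ (harmonic_gt0 n)) FQ.
  apply: filterS (filterI (filterI FA xM) FQ) => i [[Ai Mi] Qi].
  rewrite ltNge; apply/negP => ei.
  by apply: nPA; exists i.
have [k [kP korth]] := extract_asymptotically_orthogonal FF wz PF.
have wk : weakly_cvg (x_ \o k) x.
  apply: (weak_topology_cvg norm_dot) => y.
  have wk0 := asymptotically_orthogonal_weakly_to0 (M := M + `|x|) _ korth.
  have -> : (fun n => dot ((x_ \o k) n) y) =
      (fun n => dot (x_ (k n) - x) y + dot x y).
    by apply/funext => n; rewrite -dotDl subrK.
  rewrite -[X in _ --> X]add0r -{1}(dot0l dot y).
  apply: cvgD; last exact: cvg_cst.
  apply: wk0 => n; apply: (le_trans (ler_normB _ _)).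
  by have [_ + _] := kP n; rewrite lerD2r.
have Qk : Q ((x_ \o k) n) @[n --> \oo] --> Q x.
  apply/cvgrPdist_lt => d d0.
  have := near_infty_natSinv_lt (PosNum d0); apply: filterS => n nd.
  by have [_ _ +] := kP n => /lt_trans; apply.
have /cvgrPdist_lt /(_ e e0) ke := legQ _ _ wk Qk.
have /filter_ex[n] := ke.
by have [+ _ _] := kP n; rewrite leNgt => /negP.
Qed.


End LegendreForms.

(** * Quadratic functions along an unbounded family *)

Section QuadraticFunctions.
Context {R : realType} {H : completeNormedModType R}.
Context (dot : {dot H for @idfun R}) (S : {linear H -> H}) (d : H).
Context (symS : forall x y, dot (S x) y = dot x (S y)).
Implicit Types x y v : H.

Definition quad_fun x := 2^-1 * dot x (S x) + dot d x.

Lemma quad_fun_line x v t : quad_fun (x + t *: v) =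
  quad_fun x + t * (dot x (S v) + dot d v) + t ^+ 2 * (2^-1 * dot v (S v)).
Proof.
rewrite /quad_fun linearD linearZ /= !(dotE dot) -(symS v x) (dotC dot (S v)).
by field.
Qed.

Lemma quad_fun_line_null x v t : S v = 0 ->
  quad_fun (x + t *: v) = quad_fun x + t * dot d v.
Proof. by move=> Sv; rewrite quad_fun_line Sv !(dot0r dot) mulr0 add0r mulr0 addr0. Qed.

Context (lscS : lsc_along_weak dot (fun x => dot x (S x))).
Context (I : Type) (F : set_system I) {FF : ProperFilter F} (x_ : I -> H).

Lemma quad_fun_weak_limit_le x b_ b : weakly_to dot F x_ x ->
  (\forall i \near F, quad_fun (x_ i) <= b_ i) -> b_ i @[i --> F] --> b ->
  quad_fun x <= b.
Proof.
move=> wx xb bb.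
suff : dot x (S x) <= 2 * (b - dot x d) by rewrite /quad_fun (dotC dot d); lra.
apply: (lscS (b_ := fun i => 2 * (b_ i - dot (x_ i) d)) FF wx).
  by apply: filterS xb => i; rewrite /quad_fun (dotC dot d); lra.
by apply: cvgMr; apply: cvgB => //; exact: wx.
Qed.

(** In the following lemmas [r_] stands for the inverses of the norms of an
    unbounded family [x_], and v for a weak limit of the rescaled family. *)
Context (r_ : I -> R) (v : H) (r0 : r_ i @[i --> F] --> (0 : R)).
Context (wv : weakly_to dot F (fun i => r_ i *: x_ i) v).

Lemma quad_fun_rescale i : dot (r_ i *: x_ i) (S (r_ i *: x_ i)) =
  2 * (r_ i * (r_ i * quad_fun (x_ i) - dot (r_ i *: x_ i) d)).
Proof.
rewrite linearZ /= !(dotE dot) /quad_fun (dotC dot d); by field.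
Qed.

(** After division by the squared norm of x only the curvature term of a bounded
    above quadratic function survives. *)
Lemma asymptotic_direction_curvature_le0 b :
  (\forall i \near F, quad_fun (x_ i) <= b) -> dot v (S v) <= 0.
Proof.
move=> xb.
apply: (lscS (b_ := fun i => 2 * (r_ i * (r_ i * b - dot (r_ i *: x_ i) d)))
         FF wv).
  apply: filterS xb => i xb; rewrite quad_fun_rescale.
  by have := ler_wpM2l (sqr_ge0 (r_ i)) xb; lra.
rewrite (_ : 0 = 2 * (0 * (0 * b - dot v d)) :> R); last by ring.
apply: cvgMr; apply: cvgM => //; apply: cvgB; last exact: wv.
exact: cvgMl.
Qed.

Lemma rescaled_curvature_cvg0 b : quad_fun (x_ i) @[i --> F] --> (b : R) ->
  dot (r_ i *: x_ i) (S (r_ i *: x_ i)) @[i --> F] --> (0 : R).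
Proof.
move=> xb; under eq_fun do rewrite quad_fun_rescale.
rewrite (_ : 0 = 2 * (0 * (0 * b - dot v d)) :> R); last by ring.
by apply: cvgMr; apply: cvgM => //; apply: cvgB; [exact: cvgM|exact: wv].
Qed.

(** The curvature term is nonnegative and may be dropped; the rest is divided by
    the norm of x. *)
Lemma asymptotic_direction_slope_le0 b : (forall x, 0 <= dot x (S x)) ->
  (forall i, 0 <= r_ i) ->
  (\forall i \near F, quad_fun (x_ i) <= b) -> dot d v <= 0.
Proof.
move=> posS rge0 xb.
have cv : dot (r_ i *: x_ i) d - r_ i * b @[i --> F] --> dot v d - 0 * b.
  by apply: cvgB; [exact: wv|exact: cvgMl].
rewrite dotC -[dot v d]subr0 -(mul0r b); apply: (cvgr_to_le cv).
apply: filterS xb => i; have := posS (x_ i); have := rge0 i.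
by rewrite /quad_fun dotZl (dotC dot d); nra.
Qed.

End QuadraticFunctions.

(** * Existence of a minimizer *)

Unset Implicit Arguments.
Set Strict Implicit.

(* The binders dot and norm_dot make the complete normed space H a Hilbert
   space: its norm is the one induced by the inner product dot. *)
Theorem theorem3p1 (R : realType) (H : completeNormedModType R)
  (dot : {dot H for @idfun R})
  (norm_dot : forall x : H, `|x| = Num.sqrt (dot x x))
  (m : nat) (m_gt0 : (0 < m)%N)
  (T : {linear H -> H}) (Ts : 'I_m -> {linear H -> H})
  (c : H) (cs : 'I_m -> H) (alpha : 'I_m -> R) :
  let f x := 2^-1 * dot x (T x) + dot c x in
  let g i x := 2^-1 * dot x (Ts i x) + dot (cs i) x + alpha i in
  let F := [set x : H | forall i, g i x <= 0] in
  let I1 := [set i : 'I_m | (Ts i : H -> H) <> (fun=> 0)] in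
  continuous_self_adjoint dot T ->
  (forall i, positive_semidefinite dot (Ts i)) ->
  legendre_form (fun x => dot x (T x)) ->
  F !=set0 ->
  has_lbound (f @` F) ->
  (forall v, recession_cone F v -> dot v (T v) = 0 ->
     forall i, I1 i -> dot (cs i) v = 0) ->
  exists2 xbar, F xbar & forall x, F x -> f xbar <= f x.
Proof.
move=> f g F I1 [_ symT] psdTs legT F0 flb condA.
have symTs i := (psdTs i).1.2.
have lscT := weakly_lsc_lsc_along_weak norm_dot legT.1.
have lscTs i := psd_lsc_along_weak (psdTs i).
have FE x i : F x -> quad_fun dot (Ts i) (cs i) x <= - alpha i.
  by move=> /(_ i); rewrite /g /quad_fun; lra.
have EF x : (forall i, quad_fun dot (Ts i) (cs i) x <= - alpha i) -> F x.
  by move=> h i; have := h i; rewrite /g /quad_fun; lra.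
have F_closed (U : set_system nat) (x_ : nat -> H) x : UltraFilter U ->
    (forall n, F (x_ n)) -> weakly_to dot U x_ x -> F x.
  move=> UU Fx wx; apply: EF => i.
  apply: (quad_fun_weak_limit_le (lscTs i) wx _ (cvg_cst _)).
  by apply: nearW => n; apply: FE.
have infF : has_inf (f @` F).
  by split => //; case: F0 => x Fx; exists (f x), x.
pose fs := inf (f @` F).
have fsF x : F x -> fs <= f x.
  by move=> Fx; apply: ge_inf; [exact: infF.2|exists x].
(* The n-th point has minimal norm among the feasible points that are optimal
   up to harmonic n. *)
pose level n := F `&` [set x | f x <= fs + harmonic n].
have /choice[x_ xP] n : exists x, level n x /\ forall y, level n y -> `|x| <= `|y|.
  have [||x Lx xmin] := @exists_min_norm _ _ _ norm_dot (level n).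
  - have [_ [x Fx <-] xn] := inf_adherent (harmonic_gt0 n) infF.
    by exists x; split => //; exact: ltW.
  - move=> U y_ y UU Ly wy; split.
      by apply: (F_closed _ _ _ UU _ wy) => k; exact: (Ly k).1.
    apply: (quad_fun_weak_limit_le lscT wy _ (cvg_cst _)).
    by apply: nearW => k; exact: (Ly k).2.
  by exists x.
have xF n : F (x_ n) := (xP n).1.1.
have xf n : f (x_ n) <= fs + harmonic n := (xP n).1.2.
have xmin n := (xP n).2.
have [U [UU NU]] := @ultraFilterLemma _ \oo _.
have hU : fs + harmonic n @[n --> U] --> fs.
  rewrite -[X in _ --> X]addr0; apply: cvgD; first exact: cvg_cst.
  by move=> B /(@cvg_harmonic R) /NU.
(* If the norms are bounded along U, the weak limit is a minimizer. *)
have [[M xM]|unbounded] := pselect (exists M, \forall n \near U, `|x_ n| <= M).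
  have [x wx] := ultra_bounded_weakly_to norm_dot UU xM.
  exists x; first exact: (F_closed _ _ _ UU xF wx).
  move=> y /fsF; apply: le_trans.
  apply: (quad_fun_weak_limit_le lscT wx _ hU).
  by apply: nearW => n; exact: xf.
(* Otherwise they tend to infinity along U; normalize and take a weak limit. *)
exfalso.
have xoo M : \forall n \near U, M < `|x_ n|.
  have [xM|] := in_ultra_setVsetC [set n | `|x_ n| <= M] UU.
    by exfalso; apply: unbounded; exists M.
  by apply: filterS => n /= /negP; rewrite -ltNge.
pose r_ n := `|x_ n|^-1.
have r_ge0 n : 0 <= r_ n by rewrite invr_ge0.
have rU : r_ n @[n --> U] --> (0 : R).
  apply/cvgrPdist_lt => e e0; apply: filterS (xoo e^-1) => n xe.
  rewrite sub0r normrN ger0_norm// /r_ invf_plt ?posrE//.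
  by apply: lt_trans xe; rewrite invr_gt0.
(* The norm of r_ n *: x_ n is 1, or 0 if x_ n = 0. *)
have v1 n : `|r_ n *: x_ n| <= 1.
  rewrite normrZ ger0_norm// /r_; have [->|x0] := eqVneq (x_ n) 0.
    by rewrite normr0 mulr0.
  by rewrite mulVf// normr_eq0.
have [v wv] : exists v, weakly_to dot U (fun n => r_ n *: x_ n) v.
  by apply: (ultra_bounded_weakly_to norm_dot UU (M := 1)); exact: nearW.
have gx i : \forall n \near U, quad_fun dot (Ts i) (cs i) (x_ n) <= - alpha i.
  by apply: nearW => n; exact: FE.
have Tsv i : Ts i v = 0.
  apply: (psd_ker (psdTs i)).
  exact: (asymptotic_direction_curvature_le0 (lscTs i) rU wv (gx i)).
have csv i : dot (cs i) v <= 0.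
  exact: (asymptotic_direction_slope_le0 rU wv (psdTs i).2 r_ge0 (gx i)).
have recv : recession_cone F v.
  move=> x Fx t t0; apply: EF => i.
  rewrite (quad_fun_line_null (cs i) (symTs i))//.
  by have := FE _ i Fx; have := csv i; nra.
have fline x t : f (x + t *: v) = f x + t * (dot x (T v) + dot c v) +
    t ^+ 2 * (2^-1 * dot v (T v)) := quad_fun_line c symT x v t.
have fv x : F x -> 2^-1 * dot v (T v) = 0 /\ 0 <= dot x (T v) + dot c v.
  move=> Fx; apply: (@parabola_lbound _ fs (f x)).
    by move=> t t0; rewrite -fline; apply: fsF; exact: recv.
  have := asymptotic_direction_curvature_le0 lscT rU wv (b := fs + 1).
  move=> h; rewrite pmulr_rle0//; apply: h; apply: nearW => n.
  by apply: (le_trans (xf n)); rewrite lerD2l /= invf_le1// ler1n.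
have vTv : dot v (T v) = 0.
  by have [+ _] := fv _ (xF 0%N) => /eqP; rewrite mulf_eq0 invr_eq0 pnatr_eq0/= => /eqP.
(* If v were 0, the Legendre property would turn the weak convergence to 0 of
   vectors of eventually unit norm into strong convergence. *)
have v_neq0 : v != 0.
  apply/negP => /eqP v0.
  have fx : f (x_ n) @[n --> U] --> fs.
    apply: (squeeze_cvgr _ (cvg_cst fs) hU).
    by apply: nearW => n; rewrite fsF//= xf.
  have Qv : dot (r_ n *: x_ n) (T (r_ n *: x_ n)) @[n --> U] --> dot v (T v).
    by rewrite vTv; exact: (rescaled_curvature_cvg0 rU wv fx).
  have vM : \forall n \near U, `|r_ n *: x_ n| <= 1 by exact: nearW.
  have /cvgrPdist_lt sv : r_ n *: x_ n @[n --> U] --> v.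
    exact: (legendre_cvg norm_dot ultra_proper legT vM wv Qv).
  have {}sv := sv 1 ltr01.
  have /filter_ex[n []] : \forall n \near U, `|v - r_ n *: x_ n| < 1 /\ 0 < `|x_ n|.
    exact: filterI sv (xoo 0).
  rewrite v0 sub0r normrN normrZ ger0_norm// => + xn.
  by rewrite mulVf ?ltxx// gt_eqF.
have vv0 : 0 < dot v v by rewrite (dotxx norm_dot) exprn_gt0// normr_gt0.
(* By condition (A), only affine constraints can have a nonzero slope along v;
   if the slope is negative, then the constraint tends to -oo along x_. *)
have slack : \forall n \near U, forall i, dot (cs i) v < 0 ->
    quad_fun dot (Ts i) (cs i) (x_ n) + alpha i < 0.
  apply: filter_forall => i.
  have [civ|_] := ltP (dot (cs i) v) 0; last by apply: nearW.
  have Ti0 : (Ts i : H -> H) = (fun=> 0).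
    apply: contrapT => Ti0; have := condA v recv vTv i Ti0.
    by move=> e; rewrite e ltxx in civ.
  have cv : dot (r_ n *: x_ n) (cs i) + r_ n * alpha i @[n --> U] -->
      dot v (cs i) + 0 * alpha i.
    by apply: cvgD; [exact: wv|exact: cvgMl].
  rewrite mul0r addr0 (dotC dot v) in cv.
  move/cvgr_lt: cv => /(_ _ civ) cv.
  apply: filterS (filterI cv (xoo 0)) => n [+ xn] _.
  rewrite /quad_fun Ti0 !(dotE dot) (dotC dot _ (cs i)) mulr0 add0r -mulrDr.
  by rewrite pmulr_rlt0// invr_gt0.
have xv : \forall n \near U, 0 < dot (x_ n) v.
  move/cvgr_gt: (wv v) => /(_ _ vv0) cv.
  apply: filterS (filterI cv (xoo 0)) => n [+ xn].
  by rewrite dotZl pmulr_rgt0// invr_gt0.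
(* Fix one such n. A small step from x_ n in the direction - v stays in the
   same level set and shortens the vector. *)
have [n [slackn xvn]] : exists n, (forall i, dot (cs i) v < 0 ->
    quad_fun dot (Ts i) (cs i) (x_ n) + alpha i < 0) /\ 0 < dot (x_ n) v.
  exact: filter_ex (filterI slack xv).
have nearF : \forall t \near 0^'+, forall i, dot (cs i) v < 0 ->
    quad_fun dot (Ts i) (cs i) (x_ n) + alpha i + t * - dot (cs i) v < 0.
  apply: filter_forall => i.
  have [civ|_] := ltP (dot (cs i) v) 0; last by apply: nearW.
  apply: filterS (near_right0_affine_lt0 (- dot (cs i) v) (slackn i civ)).
  by move=> t.
have nearN : \forall t \near 0^'+, - (2 * dot (x_ n) v) + t * dot v v < 0.
  by apply: near_right0_affine_lt0; rewrite oppr_lt0 mulr_gt0.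
near (0 : R)^'+ => t.
have t0 : 0 < t by near: t; exact: nbhs_right_gt.
have tN : - (2 * dot (x_ n) v) + t * dot v v < 0 by near: t.
have tF : forall i, dot (cs i) v < 0 ->
    quad_fun dot (Ts i) (cs i) (x_ n) + alpha i + t * - dot (cs i) v < 0.
  by near: t.
have yF : F (x_ n + - t *: v).
  apply: EF => i; rewrite (quad_fun_line_null (cs i) (symTs i))//.
  have [civ|civ] := ltP (dot (cs i) v) 0; first by have := tF i civ; lra.
  have -> : dot (cs i) v = 0 by apply/le_anti; rewrite civ csv.
  by rewrite mulr0 addr0 FE.
have yL : level n (x_ n + - t *: v).
  split => //; apply: (le_trans _ (xf n)); rewrite fline vTv !mulr0 addr0.
  by have := (fv _ (xF n)).2; nra.
have := xmin n _ yL; apply/negP; rewrite -ltNge.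
rewrite -(ltr_pXn2r (_ : 0 < 2)%N) ?nnegrE// -!(dotxx norm_dot).
by rewrite !(dotE dot) (dotC dot v (x_ n)); nra.
Unshelve. all: by end_near. Qed.
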